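(* Let $\mu$ be a positive operator-valued measure on $\mathbb{T}$ satisfying the standing assumptions listed in the context. Then for every $n\ge0$ the monic orthogonal polynomials $\Phi_n^R$ and $\Phi_n^L$ of $\mu$ obey the recursion relations $$\Phi_{n+1}^R(z)=z\,\Phi_n^R(z)+\Phi_n^{L,*}(z)\,\Phi_{n+1}^R(0),$$ $$\Phi_{n+1}^L(z)=z\,\Phi_n^L(z)+\Phi_{n+1}^L(0)\,\Phi_n^{R,*}(z).$$
   Context: $\mathcal{H}$ is a separable complex Hilbert space, $\mathcal{L}(\mathcal{H})$ its bounded operators, $A^\dagger=A^*$ the adjoint, $\mathbb{T}$ the unit circle. An operator $A$ is positive definite if $\langle Ax,x\rangle>0$ for all $x\ne0$ and $A$ has a bounded inverse. A positive operator-valued measure is a map $\mu$ from the Borel sets of $\mathbb{T}$ to $\mathcal{L}(\mathcal{H})$ such that $\sigma\mapsto\langle\mu(\sigma)h,h\rangle$ is a positive Borel measure for every $h\in\mathcal{H}$. Its moments are $\mu_j=\int_{\mathbb{T}}e^{-ij\theta}\,d\mu(\theta)\in\mathcal{L}(\mathcal{H})$, $j\in\mathbb{Z}$, so $\mu_{-j}=\mu_j^*$. For $n\ge1$ the Toeplitz operator matrices on $\mathcal{H}^n$ are $T_n^R=[\mu_{j-k}]_{j,k=0}^{n-1}$ and $T_n^L=[\mu_{k-j}]_{j,k=0}^{n-1}$. Standing assumptions on $\mu$: $\mu$ is absolutely continuous, i.e. there is a weakly measurable $\mu':\mathbb{T}\to\mathcal{L}(\mathcal{H})$, $\mu'\ge0$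 a.e., with $d\langle\mu(\theta)h,h\rangle=\langle\mu'(e^{i\theta})h,h\rangle\frac{d\theta}{2\pi}$ for all $h$; and $\mu$ is nontrivial, in the sense that $T_n^R$ and $T_n^L$ are positive definite (with bounded inverse) for all $n\ge1$. Put $\nu_n=(\mu_{-n},\mu_{-n+1},\dots,\mu_{-1})^{T}$ (block column, entries not adjointed). The monic orthogonal polynomials are $\Phi_0^R=\Phi_0^L=I$ and, for $n\ge1$, $$\Phi_n^R(z)=z^nI-[I\ \ zI\ \cdots\ z^{n-1}I](T_n^R)^{-1}\nu_n,$$ $$\Phi_n^L(z)=z^nI-[\mu_{-n}\ \ \mu_{-n+1}\ \cdots\ \mu_{-1}](T_n^L)^{-1}\begin{pmatrix}I\\ zI\\ \vdots\\ z^{n-1}I\end{pmatrix}.$$ For an operator polynomial $P_n$ of degree $n$, the reversed polynomial is $P_n^*(z)=z^nP_n(1/\bar z)^\dagger$; $\Phi_n^{R,*}$ and $\Phi_n^{L,*}$ denote the reversed polynomials of $\Phi_n^R$ and $\Phi_n^L$. *)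

(* Defs.v *)
From HB Require Import structures.
From mathcomp Require Import all_boot all_order all_algebra.
From mathcomp Require Import ring complex.
From mathcomp Require Import all_classical all_reals all_analysis.

Set Implicit Arguments.
Unset Strict Implicit.
Unset Printing Implicit Defensive.

Import Order.TTheory GRing.Theory Num.Theory numFieldNormedType.Exports.

Local Open Scope classical_set_scope.
Local Open Scope ring_scope.
Local Open Scope complex_scope.

(* The inner product is linear in its first argument and conjugate-linear in
   the second; it induces the norm of H. *)
HB.mixin Record isSeparableHilbert (R : realType) H
    of CompleteNormedModule R[i] H := {
  dotp : {dot H for @Num.conj R[i]} ;
  dotp_norm : forall x : H, dotp x x = `|x| ^+ 2 ;
  dotp_separable : exists D : set H, countable D /\ closure D = setT
}.

#[short(type="separableHilbertType")]
HB.structure Definition SeparableHilbert (R : realType) :=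
  {H of CompleteNormedModule R[i] H & isSeparableHilbert R H}.

Notation "'⟨' x , y '⟩'" := (dotp x y)
  (at level 0, x at level 99, y at level 99, format "⟨ x ,  y ⟩") : ring_scope.

Section BoundedOperators.
Context {K : numFieldType} {V : normedModType K}.

Record bop := Bop {
  bopf :> V -> V ;
  bop_linear : linear bopf ;
  bop_bounded : exists M : K, forall x, `|bopf x| <= M * `|x| }.

HB.instance Definition _ := gen_eqMixin bop.
HB.instance Definition _ := gen_choiceMixin bop.

HB.instance Definition _ (A : bop) :=
  GRing.isLinear.Build K V V *:%R (bopf A) (bop_linear A).

Lemma bopP (A B : bop) : bopf A =1 bopf B -> A = B.
Proof.
case: A B => [f fl fb] [g gl gb] /= /funext fg.
by move: gl gb; rewrite -fg => gl gb; congr Bop; exact: Prop_irrelevance.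
Qed.

Lemma bop_bounded_ge0 (A : bop) :
  exists2 M : K, 0 <= M & forall x, `|A x| <= M * `|x|.
Proof.
have [M AM] := bop_bounded A.
have [[y y0]|V0] := pselect (exists x : V, x != 0); last first.
  exists 0 => // x; have [->|x0] := eqVneq x 0; first by rewrite linear0 !normr0 mulr0.
  by case: V0; exists x.
exists M => //; have := le_trans (normr_ge0 _) (AM y).
by rewrite pmulr_lge0 ?normr_gt0.
Qed.

Fact bop0_linear : linear (fun _ : V => 0 : V).
Proof. by move=> a x y; rewrite scaler0 addr0. Qed.
Fact bop0_bounded : exists M : K, forall x : V, `|0 : V| <= M * `|x|.
Proof. by exists 0 => x; rewrite normr0 mul0r. Qed.
Definition bop0 := Bop bop0_linear bop0_bounded.

Fact bop1_linear : linear (fun x : V => x).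
Proof. by []. Qed.
Fact bop1_bounded : exists M : K, forall x : V, `|x| <= M * `|x|.
Proof. by exists 1 => x; rewrite mul1r. Qed.
Definition bop1 := Bop bop1_linear bop1_bounded.

Fact bopD_linear (A B : bop) : linear (fun x => A x + B x).
Proof. by move=> a x y; rewrite !linearP scalerDr addrACA. Qed.
Fact bopD_bounded (A B : bop) :
  exists M : K, forall x, `|A x + B x| <= M * `|x|.
Proof.
have [M AM] := bop_bounded A; have [N BN] := bop_bounded B.
exists (M + N) => x; rewrite mulrDl (le_trans (ler_normD _ _))//.
exact: lerD.
Qed.
Definition bopD A B := Bop (bopD_linear A B) (bopD_bounded A B).

Fact bopZ_linear a (A : bop) : linear (fun x => a *: A x).
Proof. by move=> b x y; rewrite linearP scalerDr !scalerA mulrC. Qed.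
Fact bopZ_bounded a (A : bop) : exists M : K, forall x, `|a *: A x| <= M * `|x|.
Proof.
have [M AM] := bop_bounded A; exists (`|a| * M) => x.
by rewrite normrZ -mulrA ler_wpM2l.
Qed.
Definition bopZ a A := Bop (bopZ_linear a A) (bopZ_bounded a A).

Fact bopM_linear (A B : bop) : linear (fun x => A (B x)).
Proof. by move=> a x y; rewrite !linearP. Qed.
Fact bopM_bounded (A B : bop) : exists M : K, forall x, `|A (B x)| <= M * `|x|.
Proof.
have [M M0 AM] := bop_bounded_ge0 A; have [N BN] := bop_bounded B.
exists (M * N) => x; rewrite (le_trans (AM _))// -mulrA.
exact: ler_wpM2l.
Qed.
Definition bopM A B := Bop (bopM_linear A B) (bopM_bounded A B).

Fact bopDA : associative bopD.
Proof. by move=> A B C; apply: bopP => x /=; rewrite addrA. Qed.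
Fact bopDC : commutative bopD.
Proof. by move=> A B; apply: bopP => x /=; rewrite addrC. Qed.
Fact bop0D : left_id bop0 bopD.
Proof. by move=> A; apply: bopP => x /=; rewrite add0r. Qed.
Fact bopND : left_inverse bop0 (bopZ (-1)) bopD.
Proof. by move=> A; apply: bopP => x /=; rewrite scaleN1r addNr. Qed.
HB.instance Definition _ := GRing.isZmodule.Build bop bopDA bopDC bop0D bopND.

Fact bopMA : associative bopM.
Proof. by move=> A B C; apply: bopP. Qed.
Fact bop1M : left_id bop1 bopM.
Proof. by move=> A; apply: bopP. Qed.
Fact bopM1 : right_id bop1 bopM.
Proof. by move=> A; apply: bopP. Qed.
Fact bopMDl : left_distributive bopM bopD.
Proof. by move=> A B C; apply: bopP. Qed.
Fact bopMDr : right_distributive bopM bopD.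
Proof. by move=> A B C; apply: bopP => x /=; rewrite linearD. Qed.
(* Not an nzRingType, since V may be trivial. *)
HB.instance Definition _ :=
  GRing.Zmodule_isPzRing.Build bop bopMA bop1M bopM1 bopMDl bopMDr.

Fact bopZA a b A : bopZ a (bopZ b A) = bopZ (a * b) A.
Proof. by apply: bopP => x /=; rewrite scalerA. Qed.
Fact bopZ1 : left_id 1 bopZ.
Proof. by move=> A; apply: bopP => x /=; rewrite scale1r. Qed.
Fact bopZDr : right_distributive bopZ +%R.
Proof. by move=> a A B; apply: bopP => x /=; rewrite scalerDr. Qed.
Fact bopZDl A : {morph bopZ^~ A : a b / a + b}.
Proof. by move=> a b; apply: bopP => x /=; rewrite scalerDl. Qed.
HB.instance Definition _ :=
  GRing.Zmodule_isLmodule.Build K bop bopZA bopZ1 bopZDr bopZDl.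

Lemma bopDE (A B : bop) x : (A + B) x = A x + B x. Proof. by []. Qed.
Lemma bopNE (A : bop) x : (- A) x = - A x.
Proof. by rewrite -[RHS]scaleN1r. Qed.
Lemma bopZE a (A : bop) x : (a *: A) x = a *: A x. Proof. by []. Qed.
Lemma bopME (A B : bop) x : (A * B) x = A (B x). Proof. by []. Qed.
Lemma bop1E x : (1 : bop) x = x. Proof. by []. Qed.
Lemma bop0E x : (0 : bop) x = 0. Proof. by []. Qed.
Lemma bop_addr (A : bop) x y : A (x + y) = A x + A y.
Proof. exact: linearD. Qed.
Lemma bop_scaler (A : bop) a x : A (a *: x) = a *: A x.
Proof. exact: linearZ. Qed.
Lemma bop_sumE I (r : seq I) (P : pred I) (F : I -> bop) x :
  (\sum_(i <- r | P i) F i) x = \sum_(i <- r | P i) F i x.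
Proof. by elim/big_ind2: _ => // A a B b <- <-. Qed.

End BoundedOperators.
Arguments bop {K} V.

Section Circle.
Variable R : realType.

Definition unit_circle : set R[i]^o := [set z | `|z| = 1].
Definition circle : Type := set_type unit_circle.
HB.instance Definition _ := Topological.on circle.

Fact cis_subproof (t : R) : (cos t +i* sin t : R[i]^o) \in unit_circle.
Proof. by rewrite inE /unit_circle /= normc_def /= cos2Dsin2 sqrtr1. Qed.
Definition cis (t : R) : circle := SigSub (cis_subproof t).

HB.instance Definition _ := isPointed.Build circle (cis 0).

Definition borel_circle := g_sigma_algebraType (@open circle).
HB.instance Definition _ := Measurable.on borel_circle.
End Circle.

Section Adjoint.
Context {R : realType} {H : separableHilbertType R}.
Implicit Types (x y h : H) (a : R[i]).

Lemma conjc_norm x : conjc (`|x| : R[i]) = `|x|.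
Proof. exact/conj_Creal/normr_real. Qed.

Lemma real_complex_real (r : R) : r%:C \is Num.real.
Proof. by rewrite realE !lecR le_total. Qed.

Lemma dotpDl x y h : ⟨x + y, h⟩ = ⟨x, h⟩ + ⟨y, h⟩.
Proof. exact: linearDl. Qed.
Lemma dotpZl a x h : ⟨a *: x, h⟩ = a * ⟨x, h⟩.
Proof. exact: linearZl_LR. Qed.
Lemma dotpC x y : ⟨x, y⟩ = conjc ⟨y, x⟩.
Proof. by rewrite [LHS]hermC expr0 mul1r. Qed.
Lemma dotpDr x y h : ⟨h, x + y⟩ = ⟨h, x⟩ + ⟨h, y⟩.
Proof. exact: linearDr. Qed.
Lemma dotpZr a x h : ⟨h, a *: x⟩ = conjc a * ⟨h, x⟩.
Proof. exact: linearZr_LR. Qed.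
Lemma dotpBl x y h : ⟨x - y, h⟩ = ⟨x, h⟩ - ⟨y, h⟩.
Proof. exact: linearBl. Qed.
Lemma dotpBr x y h : ⟨h, x - y⟩ = ⟨h, x⟩ - ⟨h, y⟩.
Proof. exact: linearBr. Qed.

Lemma dotp0l x : ⟨0, x⟩ = 0. Proof. exact: linear0l. Qed.
Lemma dotp0r x : ⟨x, 0⟩ = 0. Proof. exact: linear0r. Qed.

Lemma dotp_ext x y : (forall h, ⟨h, x⟩ = ⟨h, y⟩) -> x = y.
Proof.
move=> xy; apply/eqP; rewrite -subr_eq0 -normr_eq0 -sqrf_eq0 -dotp_norm.
by rewrite dotpBr xy subrr.
Qed.

Lemma dotp_CS x y : `|⟨x, y⟩| <= `|x| * `|y|.
Proof.
have [->|y0] := eqVneq y 0.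
  by rewrite dotp0r !normr0 mulr0.
have yy0 : 0 < `|y| ^+ 2 by rewrite exprn_gt0 // normr_gt0.
rewrite -(@ler_pXn2r _ 2) ?nnegrE ?mulr_ge0 // exprMn -ler_pdivrMr //.
pose a := ⟨x, y⟩ / `|y| ^+ 2.
have : 0 <= `|x - a *: y| ^+ 2 by rewrite exprn_ge0.
rewrite -dotp_norm dotpBl !dotpBr !dotpZl !dotpZr (dotpC y x) !dotp_norm.
have aE : conjc a = conjc ⟨x, y⟩ / `|y| ^+ 2.
  by rewrite /a rmorphM fmorphV rmorphXn /= conjc_norm.
rewrite aE -subr_ge0 subr0 sqr_normc /a.
have : `|y| != 0 by rewrite normr_eq0.
move: (⟨x, y⟩) (`|x|) (`|y|) => u nx ny ny0.
move: (conjc u) => c.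
suff -> : nx ^+ 2 - c / ny ^+ 2 * u - (u / ny ^+ 2 * c - u / ny ^+ 2 * (c / ny ^+ 2 * ny ^+ 2)) = nx ^+ 2 - u * c / ny ^+ 2.
  by rewrite subr_ge0.
by field.
Qed.

Lemma riesz (f : H -> R[i]) (M : R[i]) :
    (forall a x y, f (a *: x + y) = a * f x + f y) ->
    0 <= M -> (forall x, `|f x| <= M * `|x|) ->
  exists y, forall x, f x = ⟨x, y⟩.
Proof.
move=> fl M0 fM.
pose G x := ⟨x, x⟩ - (f x + conjc (f x)).
pose J x := complex.Re (G x).
have GJ x : G x = (J x)%:C.
  rewrite /J RRe_real // /G addcJ dotp_norm rpredB ?rpredX ?normr_real //.
  by apply: realM; [exact: realn | exact: real_complex_real].
have J_lb : has_inf (range J).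
  split; first by exists (J 0), 0.
  exists (- (complex.Re M) ^+ 2); apply/lbP => _ [x _ <-].
  rewrite -lecR. rewrite -GJ. rewrite rmorphN rmorphXn /= RRe_real ?ger0_real // /G dotp_norm.
  rewrite addcJ.
  have fx : (complex.Re (f x))%:C <= M * `|x|.
    apply: le_trans (fM x); apply: le_trans (normc_ge_Re _).
    by rewrite lecR ler_norm.
  have : 0 <= (`|x| - M) ^+ 2.
    by rewrite real_exprn_even_ge0 // rpredB ?normr_real ?ger0_real.
  rewrite -subr_ge0 in fx => sq.
  rewrite -subr_ge0.
  have -> : `|x| ^+ 2 - 2 * (complex.Re (f x))%:C - - M ^+ 2 = (`|x| - M) ^+ 2 + 2 * (M * `|x| - (complex.Re (f x))%:C) by ring.
  by rewrite addr_ge0 // mulr_ge0.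
have f0 : f 0 = 0.
  by apply/eqP; rewrite -normr_le0 (le_trans (fM 0)) // normr0 mulr0.
have fDZ x t h : f (x + t *: h) = f x + t * f h by rewrite addrC fl addrC.
have GD x t h (r := f h - ⟨h, x⟩) :
    G (x + t *: h) = G x - t * r - conjc (t * r) + t * conjc t * `|h| ^+ 2.
  rewrite /G fDZ dotpDl !dotpDr dotpZl dotpZr dotpZl dotpZr (dotpC x h).
  rewrite /r !rmorphM rmorphD rmorphB rmorphM /= (dotp_norm h).
  by ring.
have approx (e : R) : 0 < e ->
    exists x, forall h, `|f h - ⟨h, x⟩| <= e%:C * `|h|.
  move=> e0.
  have [_ [x _ <-] xe] := inf_adherent (exprn_gt0 2 e0) J_lb.
  exists x => h.
  have [->|h0] := eqVneq h 0; first by rewrite f0 dotp0l subrr !normr0 mulr0.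
  set r := f h - _.
  have hh0 : 0 < `|h| ^+ 2 by rewrite exprn_gt0 // normr_gt0.
  pose t := conjc r / `|h| ^+ 2.
  have tE : conjc t = r / `|h| ^+ 2.
    by rewrite /t rmorphM fmorphV rmorphXn /= conjc_norm conjcK.
  have Gt : G (x + t *: h) = G x - `|r| ^+ 2 / `|h| ^+ 2.
    rewrite GD -/r rmorphM /= tE sqr_normc /t.
    have : `|h| != 0 by rewrite normr_eq0.
    move: (conjc r) (`|h|) => c nh nh0.
    by field.
  have : inf (range J) <= J (x + t *: h).
    by apply: ge_inf; [exact: J_lb.2 | exists (x + t *: h)].
  rewrite -(lerD2r (e ^+ 2)) => /(lt_le_trans xe).
  rewrite -ltcR [X in _ < X]rmorphD /= -(GJ x) -(GJ (x + t *: h)) Gt -addrA -[X in X < _]addr0 ltrD2l.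
  rewrite addrC subr_gt0 rmorphXn /= => rh.
  have : `|r| ^+ 2 <= (e%:C * `|h|) ^+ 2.
    by rewrite exprMn -ler_pdivrMr // ltW.
  by rewrite ler_pXn2r // nnegrE mulr_ge0 // lecR ltW.
pose d n : R := n.+1%:R^-1.
have d0 n : 0 < d n by rewrite invr_gt0.
have [u uP] := choice (fun n => approx (d n) (d0 n)).
have udist m n : `|u m - u n| <= (d m)%:C + (d n)%:C.
  have [->|umn] := eqVneq (u m - u n) 0.
    by rewrite normr0 addr_ge0 // lecR ltW.
  rewrite -(ler_pM2r (_ : 0 < `|u m - u n|)) ?normr_gt0 //.
  rewrite -expr2 -dotp_norm mulrDl.
  set h := u m - u n.
  rewrite -[leLHS]ger0_norm; last by rewrite dotp_norm exprn_ge0.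
  have -> : ⟨h, h⟩ = (f h - ⟨h, u n⟩) - (f h - ⟨h, u m⟩).
    by rewrite {2}/h dotpBr; ring.
  apply: le_trans (ler_normB _ _) _.
  by rewrite addrC lerD.
have dlt (e : R) : 0 < e -> exists N, forall n, (N <= n)%N -> d n < e.
  move=> e0; have [N _ NP] := near_infty_natSinv_lt (PosNum e0).
  by exists N => n Nn; exact: NP.
have Rpos (e : R[i]) : 0 < e -> exists2 e' : R, 0 < e' & e = e'%:C.
  move=> e0; exists (complex.Re e); last by rewrite RRe_real // gtr0_real.
  by rewrite -ltcR RRe_real // gtr0_real.
have : cauchy (u @ \oo).
  apply/cauchy_exP => _/posnumP[e]; have [e' e'0 ee'] := Rpos e%:num (gt0 _).
  have [N NP] := dlt (e' / 2) (divr_gt0 e'0 (ltr0Sn _ 1)).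
  exists (u N), N => // n /= Nn; rewrite -ball_normE /= ee'.
  apply: le_lt_trans (udist _ _) _.
  by rewrite -rmorphD ltcR (splitr e') ltrD // NP.
move=> /cauchy_cvgP /cvg_ex [y uy].
exists y => h.
set r := complex.Re `|f h - ⟨h, y⟩|; set nh := complex.Re `|h|.
have rE : `|f h - ⟨h, y⟩| = r%:C by rewrite RRe_real.
have nhE : `|h| = nh%:C by rewrite RRe_real ?normr_real.
have nh0 : 0 <= nh by rewrite -lecR -nhE normr_ge0.
have small (e : R) : 0 < e -> r <= e * nh.
  move=> e0; have [N NP] := dlt (e / 2) (divr_gt0 e0 (ltr0Sn _ 1)).
  have e2 : 0 < (e / 2)%:C by rewrite ltcR divr_gt0.
  move/cvgrPdist_lt : uy => /(_ _ e2) [N' _ NP'].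
  pose n := maxn N N'.
  rewrite -lecR -rE rmorphM /= -nhE.
  have -> : f h - ⟨h, y⟩ = (f h - ⟨h, u n⟩) - ⟨h, y - u n⟩.
    by rewrite dotpBr; ring.
  apply: le_trans (ler_normB _ _) _.
  rewrite (splitr e) rmorphD mulrDl lerD //.
    apply: le_trans (uP _ _) _; rewrite ler_wpM2r // lecR ltW // NP //.
    exact: leq_maxl.
  apply: le_trans (dotp_CS _ _) _; rewrite mulrC ler_wpM2r // ltW //.
  by apply: NP'; exact: leq_maxr.
apply/eqP; rewrite -subr_eq0 -normr_le0 rE lecR leNgt; apply/negP => r0.
have nh1 : 0 < nh + 1 by rewrite ltr_wpDl.
have := small (r / (nh + 1)) (divr_gt0 r0 nh1).
rewrite mulrAC ler_pdivlMr // mulrDr mulr1 gerDl leNgt r0 //.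
Qed.

(* Well defined by adjointP and adjoint_unique below *)
Definition adjoint (A : bop H) : bop H :=
  xget 0 [set B : bop H | forall x y, ⟨A x, y⟩ = ⟨x, B y⟩].

Lemma adjointP (A : bop H) x y : ⟨A x, y⟩ = ⟨x, adjoint A y⟩.
Proof.
move: x y; suff : exists B : bop H, forall x y, ⟨A x, y⟩ = ⟨x, B y⟩.
  by rewrite /adjoint; case: xgetP => [B _ AB _|noB [B /noB]//]; exact: AB.
have [M M0 AM] := bop_bounded_ge0 A.
have ex y : exists By, forall x, ⟨A x, y⟩ = ⟨x, By⟩.
  apply: (@riesz _ (M * `|y|)); [|by rewrite mulr_ge0|].
    by move=> a u v; rewrite linearP dotpDl dotpZl.
  by move=> u; rewrite (le_trans (dotp_CS _ _)) // mulrAC ler_wpM2r.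
have [B BP] := choice ex.
have Bl : linear B.
  move=> a u v; apply: dotp_ext => h.
  by rewrite -BP !dotpDr !dotpZr !BP.
have Bb : exists M : R[i], forall x, `|B x| <= M * `|x|.
  exists M => v; have [->|Bv0] := eqVneq (B v) 0.
    by rewrite normr0 mulr_ge0.
  rewrite -(ler_pM2r (_ : 0 < `|B v|)) ?normr_gt0 //.
  rewrite -expr2 -dotp_norm -BP -[leLHS]ger0_norm; last first.
    by rewrite BP dotp_norm exprn_ge0.
  apply: le_trans (dotp_CS _ _) _; rewrite mulrAC.
  by apply: ler_wpM2r; [exact: normr_ge0|exact: AM].
by exists (Bop Bl Bb) => u v; exact: BP.
Qed.

Lemma adjoint_unique (A B : bop H) :
  (forall x y, ⟨A x, y⟩ = ⟨x, B y⟩) -> adjoint A = B.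
Proof.
move=> AB; apply: bopP => y; apply: dotp_ext => x.
by rewrite -adjointP AB.
Qed.

Lemma adjointD (A B : bop H) : adjoint (A + B) = adjoint A + adjoint B.
Proof.
by apply: adjoint_unique => x y; rewrite !bopDE dotpDl dotpDr !adjointP.
Qed.
Lemma adjointZ a (A : bop H) : adjoint (a *: A) = conjc a *: adjoint A.
Proof.
by apply: adjoint_unique => x y; rewrite !bopZE dotpZl dotpZr conjcK adjointP.
Qed.
Lemma adjoint0 : adjoint (0 : bop H) = 0.
Proof. by apply: adjoint_unique => x y; rewrite !bop0E dotp0l dotp0r. Qed.
Lemma adjoint_sum I (r : seq I) (F : I -> bop H) :
  adjoint (\sum_(i <- r) F i) = \sum_(i <- r) adjoint (F i).
Proof.
elim: r => [|i r IH]; first by rewrite !big_nil adjoint0.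
by rewrite !big_cons adjointD IH.
Qed.

End Adjoint.

Definition cintegral (R : realType) d (T : measurableType d)
    (m : {measure set T -> \bar R}) (f : T -> R[i]) : R[i] :=
  (\int[m]_x complex.Re (f x)) +i* (\int[m]_x complex.Im (f x)).

(* povm_diag h is the scalar measure ⟨mu(.) h, h⟩, finite because its values
   are complex numbers; the values of mu off the Borel sets are irrelevant. *)
Record povm (R : realType) (H : separableHilbertType R) := Povm {
  povm_op :> set (borel_circle R) -> bop H ;
  povm_diag : H -> {finite_measure set (borel_circle R) -> \bar R} ;
  povm_diagE : forall h (A : set (borel_circle R)), measurable A ->
    ⟨povm_op A h, h⟩ = (fine (povm_diag h A))%:C }.

Section Moments.
Context {R : realType} {H : separableHilbertType R}.
Variable mu : povm H.

(* The operator integral is taken weakly. On a complex Hilbert space an operator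
   is determined by its quadratic form, so there is at most one such A
   (moment_unique); it exists because mu has finite total mass. *)
Definition is_moment (j : int) (A : bop H) :=
  forall h, ⟨A h, h⟩ =
    cintegral (povm_diag mu h) (fun z => (\val z : R[i]) ^ (- j)).

Definition moment (j : int) : bop H := xget 0 [set A | is_moment j A].

Lemma moment_unique j A : is_moment j A -> moment j = A.
Proof.
have quad0 (C : bop H) : (forall h, ⟨C h, h⟩ = 0) -> C = 0.
  move=> C0; apply: bopP => x; apply: dotp_ext => y.
  rewrite dotp0r dotpC.
  have := C0 (x + y); rewrite bop_addr dotpDl !dotpDr !C0 add0r addr0 => e1.
  have := C0 (x + 'i *: y).
  rewrite bop_addr bop_scaler dotpDl !dotpDr !dotpZl !dotpZr !C0 !mulr0 add0r addr0.
  move=> e2; suff -> : ⟨C x, y⟩ = 0 by rewrite conjc0.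
  have ii : conjc ('i : R[i]) = - 'i by apply/eqP; rewrite eq_complex /= oppr0 !eqxx.
  move: e2; rewrite ii mulNr addrC => /subr0_eq /(mulfI (@neq0Ci _)) e2.
  move: e1; rewrite e2 -mulr2n => /eqP; rewrite mulrn_eq0 /= => /eqP.
  by [].
move=> jA; rewrite /moment; case: xgetP => [B _ jB|noB]; last by have := noB A jA.
apply/eqP; rewrite -subr_eq0; apply/eqP/quad0 => h.
by rewrite bopDE bopNE dotpBl jA jB subrr.
Qed.

Definition toeplitzR n : 'M[bop H]_n :=
  \matrix_(j < n, k < n) moment (j%:Z - k%:Z).
Definition toeplitzL n : 'M[bop H]_n :=
  \matrix_(j < n, k < n) moment (k%:Z - j%:Z).

Definition opmx_app n (T : 'M[bop H]_n) (x : 'cV[H]_n) : 'cV[H]_n :=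
  \col_j \sum_(k < n) T j k (x k 0).
Definition dotp_col n (x y : 'cV[H]_n) : R[i] := \sum_(j < n) ⟨x j 0, y j 0⟩.

(* Bounded operators on H^n are identified with n x n matrices over L(H), the
   composition being the matrix product. *)
Definition opmx_is_inverse n (T B : 'M[bop H]_n) :=
  T *m B = 1%:M /\ B *m T = 1%:M.
Definition opmx_posdef n (T : 'M[bop H]_n) :=
  (forall x : 'cV[H]_n, x != 0 -> 0 < dotp_col (opmx_app T x) x) /\
  exists B, opmx_is_inverse T B.
Definition opmx_inv n (T : 'M[bop H]_n) : 'M[bop H]_n :=
  xget 0 [set B | opmx_is_inverse T B].

Definition nontrivial := forall n, (0 < n)%N ->
  opmx_posdef (toeplitzR n) /\ opmx_posdef (toeplitzL n).

Definition weakly_measurable (w : borel_circle R -> bop H) :=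
  forall x y, measurable_fun setT (fun z => complex.Re ⟨w z x, y⟩) /\
              measurable_fun setT (fun z => complex.Im ⟨w z x, y⟩).

Definition opnonneg (A : bop H) := forall h, 0 <= ⟨A h, h⟩.

Definition abs_continuous := exists w : borel_circle R -> bop H,
  [/\ weakly_measurable w,
      {ae lebesgue_measure,
        forall t : R, t \in `[0, 2 * pi[ -> opnonneg (w (cis t))} &
      forall h (A : set (borel_circle R)), measurable A ->
        povm_diag mu h A =
          (((2 * pi)^-1)%:E *
           \int[lebesgue_measure]_(t in [set` `[0%R, (2 * pi)%R[] `&` (@cis R @^-1` A))
             (complex.Re ⟨w (cis t) h, h⟩)%:E)%E ].

End Moments.

(* Operator polynomials of degree at most n, by their coefficients. *)
Section OperatorPolynomials.
Context {R : realType} {H : separableHilbertType R}.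

Definition oppoly (n : nat) := 'I_n.+1 -> bop H.

Definition opeval n (P : oppoly n) (z : R[i]) : bop H :=
  \sum_(k < n.+1) z ^+ k *: P k.

(* Coefficientwise, so as to make sense at 0 as well; see opeval_rev. *)
Definition oprev n (P : oppoly n) : oppoly n :=
  fun k => adjoint (P (rev_ord k)).

Lemma opeval_rev n (P : oppoly n) (z : R[i]) : z != 0 ->
  opeval (oprev P) z = z ^+ n *: adjoint (opeval P (conjc z)^-1).
Proof.
move=> z0; rewrite /opeval adjoint_sum scaler_sumr (reindex_inj rev_ord_inj) /=.
apply: eq_bigr => k _; rewrite /oprev rev_ordK adjointZ scalerA; congr (_ *: _).
rewrite rmorphXn fmorphV /= conjcK subSS exprVn.
by rewrite expfB_cond // (negbTE z0) add0n -ltnS ltn_ord.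
Qed.

Variable mu : povm H.

Definition nuR n : 'cV[bop H]_n := \col_(j < n) moment mu (j%:Z - n%:Z).
Definition nuL n : 'rV[bop H]_n := \row_(j < n) moment mu (j%:Z - n%:Z).

(* The usual closed formulas are opeval_PhiR and opeval_PhiL. *)
Definition PhiR n : oppoly n := fun k =>
  if unlift ord_max k is Some j
  then - (opmx_inv (toeplitzR mu n) *m nuR n) j 0 else 1.
Definition PhiL n : oppoly n := fun k =>
  if unlift ord_max k is Some j
  then - (nuL n *m opmx_inv (toeplitzL mu n)) 0 j else 1.

Arguments PhiR n _ : clear implicits.
Arguments PhiL n _ : clear implicits.

Lemma opeval_PhiR n z : opeval (PhiR n) z =
  z ^+ n *: (1 : bop H) - ((\row_(k < n) (z ^+ k *: (1 : bop H))) *m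
                 (opmx_inv (toeplitzR mu n) *m nuR n)) 0 0.
Proof.
rewrite /opeval big_ord_recr /= addrC /PhiR unlift_none; congr (_ + _).
rewrite mxE -sumrN; apply: eq_bigr => k _.
rewrite (_ : widen_ord _ k = lift ord_max k); last first.
  by apply: val_inj; rewrite /= /bump leqNgt ltn_ord.
rewrite liftK scalerN !mxE; congr (- _).
by apply: bopP => x; rewrite bopME.
Qed.

Lemma opeval_PhiL n z : opeval (PhiL n) z =
  z ^+ n *: (1 : bop H) - (nuL n *m opmx_inv (toeplitzL mu n) *m
                 (\col_(k < n) (z ^+ k *: (1 : bop H)))) 0 0.
Proof.
rewrite /opeval big_ord_recr /= addrC /PhiL unlift_none; congr (_ + _).
rewrite mxE -sumrN; apply: eq_bigr => k _.
rewrite (_ : widen_ord _ k = lift ord_max k); last first.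
  by apply: val_inj; rewrite /= /bump leqNgt ltn_ord.
rewrite liftK scalerN [X in _ * X]mxE; congr (- _).
by apply: bopP => x; rewrite bopME bopZE bop_scaler.
Qed.

End OperatorPolynomials.

Arguments PhiR {R H} mu n _.
Arguments PhiL {R H} mu n _.

(* Main.v *)
Require Import Defs.
From mathcomp Require Import all_boot all_order all_algebra.
From mathcomp Require Import complex.
From mathcomp Require Import all_classical all_reals all_analysis.

(** The polynomials $\Phi_n^R$, $\Phi_n^L$ and their reversals are pinned down by
    linear equations in their coefficients, and the recursion compares two
    solutions of the same equations.

    The definition of $\Phi_n^R$ says that its coefficients $c_0,\dots,c_n = 1$
    satisfy $\sum_k \mu_{j-k} c_k = 0$ for $0 \le j < n$ ([orthogonal_PhiR]).
    The coefficients $d_k$ of $\Phi_n^L$ satisfy $\sum_k d_k \mu_{j-k} = 0$ in the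
    same range ([orthogonal_PhiL]).  Since $\mu_j^* = \mu_{-j}$
    ([adjoint_moment]), taking adjoints and reversing the indices turns this
    into $\sum_k \mu_{j-k} e_k = 0$ for $1 \le j \le n$, where the $e_k$ are the
    coefficients of $\Phi_n^{L,*}$ and $e_0 = 1$ ([reversed_oprev]).

    Multiplication by $z$ moves the equations for $\Phi_n^R$ to the range
    $1 \le j \le n$.  So in that range all three of $\Phi_{n+1}^R$, $z\Phi_n^R$
    and $\Phi_n^{L,*}\Phi_{n+1}^R(0)$ satisfy the equations, and so does
    $\Phi_{n+1}^R - z\Phi_n^R - \Phi_n^{L,*}\Phi_{n+1}^R(0)$.  Its coefficients
    of degree $0$ and $n+1$ vanish because $e_0 = 1$ and the $\Phi$ are monic; the
    $n$ remaining ones form a vector killed by $T_n^R$, and $T_n^R$ is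
    injective ([szego_coef]).

    The equations for $\Phi_n^L$ are those for $\Phi_n^R$ read in the converse
    ring of bounded operators, with the same symbol $j \mapsto \mu_j$, so
    [szego_coef] in that ring gives the second recursion.  This is why the
    algebra is done in an arbitrary ring. *)

Set Implicit Arguments.
Unset Strict Implicit.
Unset Printing Implicit Defensive.

Import GRing.Theory Num.Theory.

Local Open Scope ring_scope.

(** * The algebra of the Szego recursion *)

(** For the symbol of moments this is orthogonality of the polynomial with
    coefficients [c] to the monomials of degree less than [n]. *)
Definition orthogonal_coef (A : pzRingType) (m : int -> A) (n : nat)
    (c : 'I_n.+1 -> A) : Prop :=
  forall j : 'I_n, \sum_(k < n.+1) m (j%:Z - k%:Z) * c k = 0.

(** The range of equations is now 1, ..., n: orthogonality to z, ..., z^n,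
    which is what the reversal of an orthogonal polynomial satisfies. *)
Definition reversed_orthogonal_coef (A : pzRingType) (m : int -> A) (n : nat)
    (e : 'I_n.+1 -> A) : Prop :=
  forall j : 'I_n, \sum_(k < n.+1) m (j.+1%:Z - k%:Z) * e k = 0.

Definition toeplitz_injective (A : pzRingType) (m : int -> A) (n : nat) : Prop :=
  forall x : 'I_n -> A,
    (forall j : 'I_n, \sum_(k < n) m (j%:Z - k%:Z) * x k = 0) ->
  forall k, x k = 0.

(** Coefficientwise recursion. The difference of the two sides solves the
    homogeneous Toeplitz system of size [n]: the extreme coefficients of the
    three solutions match and cancel in each equation. *)
Lemma szego_coef (A : pzRingType) (m : int -> A) (n : nat)
    (c e : 'I_n.+1 -> A) (f : 'I_n.+2 -> A) :
  toeplitz_injective m n ->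
  orthogonal_coef m c -> c ord_max = 1 ->
  reversed_orthogonal_coef m e -> e ord0 = 1 ->
  orthogonal_coef m f -> f ord_max = 1 ->
  forall k : 'I_n, f (lift ord0 (widen_ord (leqnSn n) k)) =
    c (widen_ord (leqnSn n) k) + e (lift ord0 k) * f ord0.
Proof.
move=> inj co c1 eo e1 fo f1 k; apply/eqP; rewrite -subr_eq0; apply/eqP.
move: k; apply: inj => j.
(* The equation of index j + 1 for f is matched with those of index j for c
   and of index j + 1 for e. *)
have := fo (lift ord0 j); rewrite big_ord_recl big_ord_recr /=.
have -> : lift ord0 ord_max = ord_max :> 'I_n.+2 by apply: val_inj.
have shift (a b : nat) : a.+1%:Z - b.+1%:Z = a%:Z - b%:Z.
  by rewrite !intS opprD addrACA subrr add0r.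
rewrite f1 mulr1 /bump /= subr0 add1n shift => fj.
have := co j; rewrite big_ord_recr /= c1 mulr1 => cj.
have := eo j; rewrite big_ord_recl /= e1 mulr1 subr0 => ej.
under eq_bigr do rewrite mulrBr mulrDr mulrA.
rewrite sumrB big_split /= -mulr_suml.
under [X in _ - (_ + X * _)]eq_bigr do rewrite -shift.
under eq_bigr do rewrite -shift.
move/eqP: cj; rewrite addr_eq0 => /eqP ->.
move/eqP: ej; rewrite addrC addr_eq0 => /eqP ->.
rewrite mulNr -opprD opprK addrC [X in X + _]addrC -[RHS]fj addrA.
by rewrite [X in _ = X]addrAC.
Qed.

(** * Moments of a positive operator-valued measure *)

Section Star.
Context {R : realType} {H : separableHilbertType R}.
Implicit Types A B : bop H.

Lemma adjointM A B : adjoint (A * B) = adjoint B * adjoint A.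
Proof. by apply: adjoint_unique => x y; rewrite !bopME !adjointP. Qed.

Lemma adjoint1 : adjoint (1 : bop H) = 1.
Proof. by apply: adjoint_unique. Qed.

End Star.

Lemma conjc_circle_expz (R : realType) (z : circle R) (j : int) :
  conjc ((\val z : R[i]) ^ j) = (\val z : R[i]) ^ (- j).
Proof.
have : `|\val z : R[i]| = 1 by have /set_mem := valP z.
move: (\val z : R[i]) => w w1.
have wc : conjc w = w^-1.
  have w0 : w != 0 by rewrite -normr_eq0 w1 oner_neq0.
  by apply: (mulfI w0); rewrite -sqr_normc w1 expr1n mulfV.
have /= -> := fmorphXz (conjc : {rmorphism R[i] -> R[i]}) j w.
by rewrite wc exprz_inv.
Qed.

(** Negation swaps the positive and the negative part. If both have infinite
    integral, the two sides are equal because [fine] sends both infinities to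
    zero. *)
Lemma RintegralN (R : realType) d (T : measurableType d)
    (m : {measure set T -> \bar R}) (D : set T) (f : T -> R) :
  \int[m]_(x in D) (- f x) = - \int[m]_(x in D) f x.
Proof.
rewrite /Rintegral; under eq_integral do rewrite EFinN.
rewrite integralE [in RHS]integralE funeposN funenegN.
set a := integral m D _; set b := integral m D _.
by case: a b => [r| |] [s| |] /=; rewrite ?oppr0 // opprB.
Qed.

Lemma cintegral_conj (R : realType) d (T : measurableType d)
    (m : {measure set T -> \bar R}) (f : T -> R[i]) :
  cintegral m (fun x => conjc (f x)) = conjc (cintegral m f).
Proof.
rewrite /cintegral /= -RintegralN; congr Complex;
by apply: eq_Rintegral => x _; case: (f x).
Qed.

Section Moments.
Context {R : realType} {H : separableHilbertType R} (mu : povm H).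

Lemma is_moment_adjoint j A : is_moment mu j A -> is_moment mu (- j) (adjoint A).
Proof.
move=> jA h; rewrite dotpC -adjointP jA -cintegral_conj.
by congr cintegral; apply/funext => z; rewrite conjc_circle_expz.
Qed.

(** If no operator represents the moment of index [j], then none represents the
    one of index [- j], and both moments take the default value zero. *)
Lemma adjoint_moment j : adjoint (moment mu j) = moment mu (- j).
Proof.
have [[A jA]|noj] := pselect (exists A, is_moment mu j A).
  by rewrite (moment_unique jA) (moment_unique (is_moment_adjoint jA)).
rewrite /moment; case: xgetP => [A _ jA|_]; first by case: noj; exists A.
case: xgetP => [A _ /is_moment_adjoint jA|_]; last exact: adjoint0.
by case: noj; exists (adjoint A); move: jA; rewrite opprK.
Qed.

End Moments.

(** * Orthogonal polynomials *)

Section OrthogonalPolynomials.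
Context {R : realType} {H : separableHilbertType R} (mu : povm H).

Lemma opmx_invP n (T : 'M[bop H]_n) :
  (exists B, opmx_is_inverse T B) -> opmx_is_inverse T (opmx_inv T).
Proof. by rewrite /opmx_inv => -[B TB]; case: xgetP => // /(_ B). Qed.

(** Nontriviality concerns positive sizes only; the degree 0 polynomials involve
    the empty matrix. *)
Lemma opmx_invP0 (T : 'M[bop H]_0) : opmx_is_inverse T (opmx_inv T).
Proof. by split; rewrite !thinmx0; apply: thinmx0. Qed.

Lemma opmx_inv_toeplitzR n : nontrivial mu ->
  opmx_is_inverse (toeplitzR mu n) (opmx_inv (toeplitzR mu n)).
Proof.
case: n => [|n] mu_nt; first exact: opmx_invP0.
by apply: opmx_invP; have [[_ ]] := mu_nt n.+1 isT.
Qed.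

Lemma opmx_inv_toeplitzL n : nontrivial mu ->
  opmx_is_inverse (toeplitzL mu n) (opmx_inv (toeplitzL mu n)).
Proof.
case: n => [|n] mu_nt; first exact: opmx_invP0.
by apply: opmx_invP; have [_ [_ ]] := mu_nt n.+1 isT.
Qed.

Lemma toeplitz_injectiveR n : nontrivial mu -> toeplitz_injective (moment mu) n.
Proof.
move=> /(opmx_inv_toeplitzR n)[_ BT] x xT k.
have : toeplitzR mu n *m (\col_i x i) = 0.
  apply/matrixP => i j; rewrite !mxE -[RHS](xT i).
  by apply: eq_bigr => l _; rewrite !mxE.
move=> /(congr1 (mulmx (opmx_inv (toeplitzR mu n)))).
by rewrite mulmxA BT mul1mx mulmx0 => /matrixP/(_ k 0); rewrite !mxE.
Qed.

(** In the converse ring the homogeneous system reads as a row vector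
    multiplied by [toeplitzL mu n], so a right inverse is what makes it
    injective. *)
Lemma toeplitz_injectiveL n : nontrivial mu ->
  toeplitz_injective (moment mu : int -> (bop H)^c) n.
Proof.
move=> /(opmx_inv_toeplitzL n)[TB _] x xT k.
have : (\row_i x i : 'rV[bop H]_n) *m toeplitzL mu n = 0.
  apply/matrixP => i j; rewrite !mxE -[RHS](xT j).
  by apply: eq_bigr => l _; rewrite !mxE.
move=> /(congr1 (mulmx^~ (opmx_inv (toeplitzL mu n)))).
by rewrite -mulmxA TB mulmx1 mul0mx => /matrixP/(_ 0 k); rewrite !mxE.
Qed.

Lemma PhiR_max n : PhiR mu n ord_max = 1.
Proof. by rewrite /PhiR unlift_none. Qed.

Lemma PhiL_max n : PhiL mu n ord_max = 1.
Proof. by rewrite /PhiL unlift_none. Qed.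

Lemma widen_ord_lift n (k : 'I_n) :
  widen_ord (leqnSn n) k = lift ord_max k.
Proof. by apply: val_inj; rewrite /= /bump leqNgt ltn_ord. Qed.

Lemma orthogonal_PhiR n : nontrivial mu ->
  orthogonal_coef (moment mu) (PhiR mu n).
Proof.
move=> /(opmx_inv_toeplitzR n)[TB _] j; rewrite big_ord_recr /= PhiR_max mulr1.
under eq_bigr do rewrite widen_ord_lift /PhiR liftK mulrN.
rewrite sumrN; apply/eqP; rewrite addrC subr_eq0; apply/eqP.
transitivity ((toeplitzR mu n *m (opmx_inv (toeplitzR mu n) *m nuR mu n)) j 0).
  by rewrite mulmxA TB mul1mx mxE.
by rewrite mxE; apply: eq_bigr => k _; rewrite [toeplitzR _ _ _ _]mxE.
Qed.

Lemma orthogonal_PhiL n : nontrivial mu ->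
  orthogonal_coef (moment mu : int -> (bop H)^c) (PhiL mu n).
Proof.
move=> /(opmx_inv_toeplitzL n)[_ BT] j; rewrite big_ord_recr /= PhiL_max mulr1.
under eq_bigr do rewrite widen_ord_lift /PhiL liftK mulrN.
rewrite sumrN; apply/eqP; rewrite addrC subr_eq0; apply/eqP.
transitivity ((nuL mu n *m opmx_inv (toeplitzL mu n) *m toeplitzL mu n) 0 j).
  by rewrite -mulmxA BT mulmx1 mxE.
by rewrite mxE; apply: eq_bigr => k _; rewrite [toeplitzL _ _ _ _]mxE.
Qed.

Lemma reversed_moment n (j : 'I_n) (k : 'I_n.+1) :
  - ((rev_ord j)%:Z - (rev_ord k)%:Z) = j.+1%:Z - k%:Z.
Proof.
rewrite /= subSS -!subzn ?ltn_ord -1?ltnS ?ltn_ord // opprB.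
by rewrite opprB addrC addrA subrK.
Qed.

(** Adjoints reverse products, hence exchange the two rings, and the
    substitution j -> n - j, k -> n - k sends j - k to its opposite, which the
    adjoint of a moment compensates. *)
Lemma reversed_oprev n (P : oppoly n) :
  orthogonal_coef (moment mu : int -> (bop H)^c) P ->
  reversed_orthogonal_coef (moment mu) (oprev P).
Proof.
move=> oP j; have := congr1 adjoint (oP (rev_ord j)).
rewrite adjoint0 adjoint_sum (reindex_inj rev_ord_inj) /= => {2}<-.
apply: eq_bigr => k _.
by rewrite -reversed_moment -adjoint_moment -adjointM.
Qed.

Lemma reversed_oprevC n (P : oppoly n) :
  orthogonal_coef (moment mu) P ->
  reversed_orthogonal_coef (moment mu : int -> (bop H)^c) (oprev P).
Proof.
move=> oP j; have := congr1 adjoint (oP (rev_ord j)).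
rewrite adjoint0 adjoint_sum (reindex_inj rev_ord_inj) /= => {2}<-.
apply: eq_bigr => k _.
by rewrite -reversed_moment -adjoint_moment; exact/esym/adjointM.
Qed.

Lemma oprev0 n (P : @oppoly R H n) : P ord_max = 1 -> oprev P ord0 = 1.
Proof.
by move=> P1; rewrite /oprev (_ : rev_ord ord0 = ord_max) ?P1 ?adjoint1 //;
  apply: val_inj; rewrite /= subn1.
Qed.

Lemma opeval0 n (P : @oppoly R H n) : opeval P 0 = P ord0.
Proof.
rewrite /opeval big_ord_recl expr0 scale1r big1 ?addr0 // => k _.
by rewrite expr0n /= scale0r.
Qed.

Lemma opeval_recursion n (f : @oppoly R H n.+1) (c g : @oppoly R H n) z :
  f ord_max = c ord_max -> f ord0 = g ord0 ->
  (forall k : 'I_n, f (lift ord0 (widen_ord (leqnSn n) k)) =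
    c (widen_ord (leqnSn n) k) + g (lift ord0 k)) ->
  opeval f z = z *: opeval c z + opeval g z.
Proof.
move=> f1 f0 fk; rewrite {1}/opeval big_ord_recl big_ord_recr.
rewrite [opeval c z]/opeval big_ord_recr [opeval g z]/opeval big_ord_recl /=.
have -> : lift ord0 ord_max = ord_max :> 'I_n.+2 by apply: val_inj.
rewrite f1 f0 scalerDr scalerA -exprS.
under eq_bigr do rewrite fk scalerDr.
rewrite big_split /= scaler_sumr.
under [X in _ = X + _ + _]eq_bigr do rewrite scalerA -exprS.
by rewrite [X in _ + X = _]addrAC addrCA.
Qed.

End OrthogonalPolynomials.

Theorem theorem4p1 (R : realType) (H : separableHilbertType R) (mu : povm H)
    (mu_ac : abs_continuous mu) (mu_nontrivial : nontrivial mu)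
    (n : nat) (z : R[i]) :
  opeval (PhiR mu n.+1) z =
    z *: opeval (PhiR mu n) z +
    opeval (oprev (PhiL mu n)) z * opeval (PhiR mu n.+1) 0
  /\
  opeval (PhiL mu n.+1) z =
    z *: opeval (PhiL mu n) z +
    opeval (PhiL mu n.+1) 0 * opeval (oprev (PhiR mu n)) z.
Proof.
have mulrE (P : @oppoly R H n) (B : bop H) :
    opeval P z * B = opeval (fun k => P k * B) z.
  by rewrite /opeval mulr_suml; apply: eq_bigr => k _; apply: bopP.
have mullE (P : @oppoly R H n) (B : bop H) :
    B * opeval P z = opeval (fun k => B * P k) z.
  rewrite /opeval mulr_sumr; apply: eq_bigr => k _; apply: bopP => x.
  by rewrite bopME bopZE bop_scaler.
rewrite !opeval0 mulrE mullE; split; apply: opeval_recursion.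
- by rewrite !PhiR_max.
- by rewrite oprev0 ?mul1r ?PhiL_max.
- apply: (@szego_coef _ (moment mu)); rewrite ?PhiR_max ?oprev0 ?PhiL_max //.
  + exact: toeplitz_injectiveR.
  + exact: orthogonal_PhiR.
  + exact/reversed_oprev/orthogonal_PhiL.
  + exact: orthogonal_PhiR.
- by rewrite !PhiL_max.
- by rewrite oprev0 ?mulr1 ?PhiR_max.
- apply: (@szego_coef (bop H)^c (moment mu)); rewrite ?PhiL_max ?oprev0 ?PhiR_max //.
  + exact: toeplitz_injectiveL.
  + exact: orthogonal_PhiL.
  + exact/reversed_oprevC/orthogonal_PhiR.
  + exact: orthogonal_PhiL.
Qed.
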